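(* Consider the looped Markov chain $\mathcal{G}'$ described in the context, with parameters $r\ge1$, $p,p_c\in[0,1]$, and let $\nu=p\,p_c$ with $\nu\cdot r<1$. Let $\alpha=\alpha_1\cdots\alpha_t\in\{1,\ldots,r\}^*$ ($t\ge0$) and $1\le i\le r$. Then the mean hitting time of $s_i^\alpha$ from $\sharp$ is $$m_\sharp(s_i^\alpha)=\nu^{-t}+(i-1)\Delta+\sum_{k=1}^{t}\frac{1+p+(\alpha_k-1)\Delta+(1-\nu)\sum_{s=1}^{k}(r-\alpha_s)\Delta}{\nu^{t+1-k}}.$$
   Context: Fix an integer $r\ge1$ and probabilities $p,p_c\in[0,1]$. Words $\alpha\in\{1,\ldots,r\}^*$ (finite sequences, $\varepsilon$ empty word, $\alpha\cdot i$ concatenation, $r^k$ the word of $k$ letters $r$) are called blocks. The Markov chain $\mathcal{G}'$ has the countable state space $\{s_i^\alpha, c_i^\alpha : 1\le i\le r,\ \alpha\in\{1,\ldots,r\}^*\}\cup\{\sharp\}$, initial state $\sharp$, and transition probabilities (all unlisted ones are $0$): $p(\sharp,s_1^\varepsilon)=1$; $p(s_i^\alpha,c_i^\alpha)=p$ for $1\le i\le r$; $p(s_i^\alpha,s_{i+1}^\alpha)=1-p$ for $1\le i<r$; $p(c_i^\alpha,s_1^{\alpha\cdot i})=p_c$ for $1\le i\le r$; $p(c_i^\alpha,s_{i+1}^\alpha)=1-p_c$ for $1\le i<r$; for every word $\gamma=\beta\cdot i\cdot r^k$ with $1\le i<r$, $k\ge0$: $p(s_r^\gamma,s_{i+1}^\beta)=1-p$,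 $p(c_r^\gamma,s_{i+1}^\beta)=1-p_c$; for every $\gamma\in r^*$ (including $\varepsilon$): $p(s_r^\gamma,\sharp)=1-p$, $p(c_r^\gamma,\sharp)=1-p_c$. (This is the chain of the guard strategy with $p_1=\cdots=p_r=p$, in which the terminal state is merged into $\sharp$ so that generation is repeated forever, and $\sharp$ always proceeds to $s_1^\varepsilon$.) For states $x,y$, $m_x(y)$ denotes the expected value of $\inf\{n\ge0: X_n=y\}$ for the chain $(X_n)$ started at $X_0=x$. Let $C:=m_{s_1^\varepsilon}(\sharp)$ and $\Delta:=1+p(1+p_c C)$. *)

(* Defs.v *)
From mathcomp Require Import all_boot all_order all_algebra.
From mathcomp Require Import all_classical all_reals all_analysis.

Set Implicit Arguments.
Unset Strict Implicit.
Unset Printing Implicit Defensive.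

Import Order.TTheory GRing.Theory Num.Theory.
Local Open Scope ring_scope.

(* States of the looped chain G':  Sharp = the state #,
   Sst i a = s_i^a,  Cst i a = c_i^a  (a : block, a word over {1..r}). *)
Inductive state : Type :=
| Sharp : state
| Sst : nat -> seq nat -> state
| Cst : nat -> seq nat -> state.

Definition state_eqb (x y : state) : bool :=
  match x, y with
  | Sharp, Sharp => true
  | Sst i a, Sst j b => (i == j) && (a == b)
  | Cst i a, Cst j b => (i == j) && (a == b)
  | _, _ => false
  end.

Definition valid_word (r : nat) (a : seq nat) : bool :=
  all (fun x => (1 <= x <= r)%N) a.

(* Given rl = rev gamma, strips the trailing letters r of gamma:
   if gamma = beta . j . r^k with j <> r, returns Some (j, beta);
   if gamma is in r^*, returns None. *)
Fixpoint pop_r (r : nat) (rl : seq nat) : option (nat * seq nat) :=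
  match rl with
  | [::] => None
  | x :: t => if x == r then pop_r r t else Some (x, rev t)
  end.

Definition ret_target (r : nat) (gamma : seq nat) : state :=
  match pop_r r (rev gamma) with
  | None => Sharp
  | Some (j, beta) => Sst j.+1 beta
  end.

(* Transitions (probability, target) of G'; targets in each list are distinct.
   Non-states (indices out of range) get no transitions; they are unreachable
   from Sharp. *)
Definition trans (R : realType) (r : nat) (p pc : R) (x : state)
  : seq (R * state) :=
  match x with
  | Sharp => [:: (1, Sst 1 [::])]
  | Sst i a =>
      if (1 <= i < r)%N && valid_word r a then
        [:: (p, Cst i a); (1 - p, Sst i.+1 a)]
      else if (0 < r)%N && (i == r) && valid_word r a then
        [:: (p, Cst r a); (1 - p, ret_target r a)]
      else [::]
  | Cst i a =>
      if (1 <= i < r)%N && valid_word r a then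
        [:: (pc, Sst 1 (rcons a i)); (1 - pc, Sst i.+1 a)]
      else if (0 < r)%N && (i == r) && valid_word r a then
        [:: (pc, Sst 1 (rcons a r)); (1 - pc, ret_target r a)]
      else [::]
  end.

(* tailP n x = P_x(T_y > n), where T_y = inf {n >= 0 : X_n = y}. *)
Fixpoint tailP (R : realType) (r : nat) (p pc : R) (y : state) (n : nat)
  (x : state) : R :=
  match n with
  | O => if state_eqb x y then 0 else 1
  | n'.+1 => if state_eqb x y then 0
             else \sum_(e <- trans r p pc x) e.1 * tailP r p pc y n' e.2
  end.

(* m_x(y) = E_x[T_y] = sum_{n >= 0} P_x(T_y > n), in the extended reals
   (equal to +oo if T_y = oo with positive probability). *)
Definition mean_hit (R : realType) (r : nat) (p pc : R) (x y : state)
  : \bar R :=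
  (\sum_(0 <= n <oo) (tailP r p pc y n x)%:E)%E.

(* Main.v *)
(* A nonnegative function [h] with [h y = 0] and [h = 1 + P h] off [y], growing at
   most linearly in the depth of the tree, equals [m_x(y)]: after [n] steps the
   defect [h x - sum_(k < n) P_x(T > k)] is at most [O(n) P_x(T > n)], which is
   small for some [n], since otherwise [sum_k P_x(T > k)] would diverge like the
   harmonic series although it is bounded by [h x].
   Such an [h] is built by moving the target through the tree. Passing from
   [s_j^a] to its sibling [s_{j+1}^a] adds the mean duration [Delta] of one letter.
   Passing to its child [s_1^{a.j}] adds the mean length of a sequence of attempts,
   each succeeding with probability [nu]; after a failure the chain returns to [#]
   through the remaining letters of [a.j] and must reach [s_j^a] again. *)
Require Import Defs.
From mathcomp Require Import all_boot all_order all_algebra.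
From mathcomp Require Import all_classical all_reals all_analysis.
From mathcomp Require Import lra ring zify.

Set Implicit Arguments.
Unset Strict Implicit.
Unset Printing Implicit Defensive.

Import Order.TTheory GRing.Theory Num.Theory.
Local Open Scope ring_scope.

(** * Blocks and return targets *)

Lemma state_eqbP (x y : state) : reflect (x = y) (state_eqb x y).
Proof.
case: x y => [|i a|i a] [|j b|j b] /=; try by constructor.
  by apply: (iffP andP) => [[/eqP-> /eqP->]|[-> ->]].
by apply: (iffP andP) => [[/eqP-> /eqP->]|[-> ->]].
Qed.

Lemma state_eqb_refl (x : state) : state_eqb x x.
Proof. exact/state_eqbP. Qed.

(* [key x] is the block [a . i] of [x = s_i^a] or [x = c_i^a]. *)
Definition key (x : state) : seq nat :=
  match x with Sharp => [::] | Sst i a => rcons a i | Cst i a => rcons a i end.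

Definition valid_state (r : nat) (x : state) : bool := valid_word r (key x).

Lemma valid_rcons (r : nat) (a : seq nat) (i : nat) :
  valid_word r (rcons a i) = (1 <= i <= r)%N && valid_word r a.
Proof. by rewrite /valid_word all_rcons. Qed.

Lemma ret_target_rcons (r : nat) (a : seq nat) (i : nat) :
  ret_target r (rcons a i) = if i == r then ret_target r a else Sst i.+1 a.
Proof. by rewrite /ret_target rev_rcons /=; case: (i == r); rewrite ?revK. Qed.

Lemma ret_target_is_Cst (r : nat) (a : seq nat) (k : nat) (b : seq nat) :
  ret_target r a <> Cst k b.
Proof.
elim/last_ind: a => [//|a i IH]; rewrite ret_target_rcons.
by case: (i == r).
Qed.

Lemma size_key_ret_target (r : nat) (a : seq nat) :
  (size (key (ret_target r a)) <= size a)%N.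
Proof.
elim/last_ind: a => [//|a i IH]; rewrite ret_target_rcons size_rcons.
by case: (i == r) => /=; [exact: leqW | rewrite size_rcons].
Qed.

Lemma valid_ret_target (r : nat) (a : seq nat) :
  valid_word r a -> valid_state r (ret_target r a).
Proof.
elim/last_ind: a => [//|a i IH]; rewrite ret_target_rcons valid_rcons.
move=> /andP[ir va]; case: eqP => [_|ne]; first exact: IH.
by rewrite /valid_state /= valid_rcons va andbT; lia.
Qed.

(** A return ends at [Sharp] or at a letter of index at least 2. Hence [s_1^a] is entered only from
    its parent, or from [Sharp] if [a] is empty. *)
Lemma ret_target_neq_first (r : nat) (g a : seq nat) :
  valid_word r g -> ret_target r g <> Sst 1 a.
Proof.
elim/last_ind: g => [//|g i IH]; rewrite ret_target_rcons valid_rcons.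
move=> /andP[ir vg]; case: eqP => [_|ne]; first exact: IH.
by case=> e _; lia.
Qed.

(** * One-step operator and tail probabilities *)

Section Chain.
Variables (R : realType) (r : nat) (p pc : R).
Hypotheses (r_gt0 : (1 <= r)%N) (p01 : 0 <= p <= 1) (pc01 : 0 <= pc <= 1).

Definition step (F : state -> R) (x : state) : R :=
  \sum_(e <- trans r p pc x) e.1 * F e.2.

Lemma step_Sharp (F : state -> R) : step F Sharp = F (Sst 1 [::]).
Proof. by rewrite /step /= big_seq1 mul1r. Qed.

(** For [k < r] the return target of [b . k] is the next sibling, so [ret_target] covers both
    branches of [trans]. *)
Lemma step_Sst (F : state -> R) (k : nat) (b : seq nat) :
  valid_word r (rcons b k) ->
  step F (Sst k b) = p * F (Cst k b) + (1 - p) * F (ret_target r (rcons b k)).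
Proof.
rewrite valid_rcons /step /= ret_target_rcons => /andP[kr ->].
case: (eqVneq k r) => [->|ne]; first last.
  by rewrite andbT ifT; [rewrite big_cons big_seq1 | lia].
by rewrite ltnn andbF /= !andbT ifT; [rewrite big_cons big_seq1 | lia].
Qed.

Lemma step_Cst (F : state -> R) (k : nat) (b : seq nat) :
  valid_word r (rcons b k) ->
  step F (Cst k b) =
  pc * F (Sst 1 (rcons b k)) + (1 - pc) * F (ret_target r (rcons b k)).
Proof.
rewrite valid_rcons /step /= ret_target_rcons => /andP[kr ->].
case: (eqVneq k r) => [->|ne]; first last.
  by rewrite andbT ifT; [rewrite big_cons big_seq1 | lia].
by rewrite ltnn andbF /= !andbT ifT; [rewrite big_cons big_seq1 | lia].
Qed.

Lemma tailP_S (y : state) (n : nat) (x : state) :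
  tailP r p pc y n.+1 x = if state_eqb x y then 0 else step (tailP r p pc y n) x.
Proof. by []. Qed.

Lemma step_sum (F : nat -> state -> R) (n : nat) (x : state) :
  step (fun z => \sum_(k < n) F k z) x = \sum_(k < n) step (F k) x.
Proof.
by rewrite /step exchange_big; apply: eq_bigr => e _; rewrite mulr_sumr.
Qed.

Lemma stepD (F G : state -> R) (x : state) :
  step (fun z => F z + G z) x = step F x + step G x.
Proof. by rewrite /step -big_split; apply: eq_bigr => e _; rewrite mulrDr. Qed.

Lemma stepZ (c : R) (F : state -> R) (x : state) :
  step (fun z => c * F z) x = c * step F x.
Proof. by rewrite /step mulr_sumr; apply: eq_bigr => e _; rewrite mulrCA. Qed.

Lemma step_cst (c : R) (x : state) :
  valid_state r x -> step (fun=> c) x = c.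
Proof.
case: x => [|k b|k b] v; rewrite ?step_Sharp ?step_Sst ?step_Cst //; ring.
Qed.

(** One step lengthens the key by at most one letter. This locality lets a bound that grows with the
    depth propagate. *)
Lemma step_le (F G : state -> R) (x : state) :
  valid_state r x ->
  (forall z, valid_state r z -> (size (key z) <= (size (key x)).+1)%N ->
     F z <= G z) ->
  step F x <= step G x.
Proof.
move: p01 pc01 => /andP[p0 p1] /andP[c0 c1].
case: x => [|k b|k b] v FG; rewrite ?step_Sharp ?step_Sst ?step_Cst //.
- by apply: FG; rewrite // /valid_state /= /valid_word /= r_gt0.
- apply: lerD; apply: ler_wpM2l; rewrite ?subr_ge0 //; apply: FG => //.
  exact: valid_ret_target.
  exact: leqW (size_key_ret_target _ _).
- apply: lerD; apply: ler_wpM2l; rewrite ?subr_ge0 //; apply: FG => //.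
  by rewrite /valid_state /= valid_rcons r_gt0.
  by rewrite /= !size_rcons.
  exact: valid_ret_target.
  exact: leqW (size_key_ret_target _ _).
Qed.

Lemma step_ge0 (F : state -> R) (x : state) :
  valid_state r x -> (forall z, valid_state r z -> 0 <= F z) -> 0 <= step F x.
Proof. by move=> v F0; rewrite -[0](step_cst 0 v); apply: step_le => // z /F0. Qed.

Lemma tailP_ge0 (y : state) (n : nat) (x : state) :
  valid_state r x -> 0 <= tailP r p pc y n x.
Proof.
elim: n x => [|n IH] x v; first by rewrite /=; case: ifP.
by rewrite tailP_S; case: ifP => // _; apply: step_ge0.
Qed.

Lemma tailP_decr (y : state) (n : nat) (x : state) :
  valid_state r x -> tailP r p pc y n.+1 x <= tailP r p pc y n x.
Proof.
elim: n x => [|n IH] x v; rewrite tailP_S [leRHS]/=; case: ifP => // _.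
  rewrite -[leRHS](step_cst 1 v); apply: step_le => // z _ _.
  by rewrite /=; case: ifP.
by apply: step_le => // z vz _; exact: IH.
Qed.

Lemma tailP_nonincreasing (y : state) (m n : nat) (x : state) :
  valid_state r x -> (m <= n)%N -> tailP r p pc y n x <= tailP r p pc y m x.
Proof.
move=> v /subnKC <-; elim: (n - m)%N => [|k IH]; first by rewrite addn0.
by rewrite addnS; apply: le_trans IH; exact: tailP_decr.
Qed.

(** * Potentials and mean hitting times *)

Section Potential.
Variables (y : state) (h : state -> R) (B : R).
Hypotheses (hy : h y = 0)
  (h_ge0 : forall x, valid_state r x -> 0 <= h x)
  (h_growth : forall x, valid_state r x -> h x <= B * (size (key x)).+1%:R)
  (h_harmonic : forall x, valid_state r x -> x <> y -> h x = 1 + step h x).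

(* [residual n x] is the expectation of [h X_n] on the event that [y] has not
   been hit by time [n], for the chain started at [x]. *)
Fixpoint residual (n : nat) (x : state) : R :=
  if state_eqb x y then 0 else if n is n'.+1 then step (residual n') x else h x.

Lemma tail_sum_residual (n : nat) (x : state) :
  valid_state r x -> \sum_(k < n) tailP r p pc y k x + residual n x = h x.
Proof.
elim: n x => [|n IH] x v.
  by rewrite big_ord0 add0r /=; case: state_eqbP => // ->.
case: (@state_eqbP x y) => [->|xy].
  rewrite /= state_eqb_refl addr0 hy big1 // => k _.
  by case: (k : nat) => [|m]; rewrite /= state_eqb_refl.
have xyb : state_eqb x y = false by apply/state_eqbP.
rewrite h_harmonic // big_ord_recl [tailP _ _ _ _ _ _]/= [residual _ _]/= xyb -addrA.
congr (_ + _).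
under eq_bigr => i _ do rewrite lift0 tailP_S xyb.
(* [IH] holds at valid states only, so equality under [step] comes from monotonicity in both
   directions. *)
rewrite -step_sum -stepD; apply/eqP; rewrite eq_le.
by apply/andP; split; apply: step_le => // z vz _; rewrite IH.
Qed.

Lemma residual_ge0 (n : nat) (x : state) : valid_state r x -> 0 <= residual n x.
Proof.
elim: n x => [|n IH] x v /=; case: ifP => // _; first exact: h_ge0.
exact: step_ge0.
Qed.

Lemma growth_const_ge0 : 0 <= B.
Proof.
have v : valid_state r Sharp by [].
have := le_trans (h_ge0 v) (h_growth v).
by rewrite /= mulr1.
Qed.

(** In [n] steps the key gains at most [n] letters, which bounds [h] at the surviving states. *)
Lemma residual_le (n : nat) (x : state) : valid_state r x ->
  residual n x <= B * (size (key x) + n).+1%:R * tailP r p pc y n x.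
Proof.
elim: n x => [|n IH] x v; rewrite [residual _ _]/=.
  rewrite [tailP _ _ _ _ _ _]/= addn0.
  by case: ifP => _; rewrite ?mulr0 ?mulr1 // h_growth.
rewrite tailP_S; case: ifP => _; first by rewrite mulr0.
rewrite -stepZ; apply: step_le => // z vz sz.
apply: (le_trans (IH z vz)); apply: ler_wpM2r; first exact: tailP_ge0.
by apply: ler_wpM2l; [exact: growth_const_ge0 | rewrite ler_nat; lia].
Qed.

Lemma residual_small (x : state) (e : R) :
  valid_state r x -> 0 < e -> exists n, residual n x <= e.
Proof.
move=> v e0; apply: contrapT => nex.
have res_gt n : e < residual n x.
  by rewrite ltNge; apply/negP => le; apply: nex; exists n.
have B0 : 0 < B.
  rewrite lt_neqAle growth_const_ge0 andbT eq_sym; apply/eqP => BE.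
  have := lt_le_trans (lt_trans e0 (res_gt 0%N)) (residual_le 0 v).
  by rewrite BE !mul0r ltxx.
pose d := (size (key x)).+1; pose S n := \sum_(k < n) tailP r p pc y k x.
(* The [m] tails with indices from [m] to [2m - 1] are at least the tail at [2m], which is at least
   [e / (3 B m)] because [d + 2m <= 3m]. *)
have S_double m : (d <= m)%N -> S m + e / (B * 3) <= S (m + m)%N.
  move=> dm; rewrite /S big_split_ord /= lerD2l.
  have -> : e / (B * 3) = \sum_(i < m) (e / (B * 3 * m%:R)).
    rewrite sumr_const card_ord -mulr_natr.
    have m0 : m%:R != 0 :> R by rewrite pnatr_eq0; lia.
    by field; rewrite m0 gt_eqF.
  apply: ler_sum => i _.
  apply: (@le_trans _ _ (tailP r p pc y (m + m) x)); last first.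
    by apply: tailP_nonincreasing => //; rewrite leq_add2l ltnW.
  have m0 : 0 < m%:R :> R by rewrite ltr0n; lia.
  rewrite ler_pdivrMr ?mulr_gt0 //.
  apply: (le_trans (ltW (res_gt (m + m)%N))).
  apply: (le_trans (residual_le _ v)); rewrite mulrC.
  apply: ler_wpM2l; first exact: tailP_ge0.
  rewrite -mulrA; apply: ler_wpM2l; first exact: ltW.
  by rewrite -natrM ler_nat; move: dm; rewrite /d; lia.
have S_ge j : j%:R * (e / (B * 3)) <= S (2 ^ j * d)%N.
  elim: j => [|j IH].
    by rewrite mul0r; apply: sumr_ge0 => i _; exact: tailP_ge0.
  rewrite -natr1 mulrDl mul1r expnS -mulnA mul2n -addnn.
  apply: le_trans (S_double _ _); first by rewrite lerD2r.
  by rewrite leq_pmull // expn_gt0.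
have c0 : 0 < e / (B * 3) by rewrite divr_gt0 // mulr_gt0.
have S_le n : S n <= h x.
  by rewrite -(tail_sum_residual n v) lerDl residual_ge0.
(* Enough doublings make the lower bound exceed [h x], which bounds all partial sums. *)
have := le_trans (S_ge (Num.bound (h x / (e / (B * 3))))) (S_le _).
rewrite -ler_pdivlMr // leNgt => /negP; apply.
apply: archi_boundP; apply: divr_ge0; [exact: h_ge0 | exact: ltW].
Qed.

Lemma mean_hit_potential (x : state) :
  valid_state r x -> mean_hit r p pc x y = (h x)%:E.
Proof.
move=> v; have t0 n : (0 <= (tailP r p pc y n x)%:E)%E.
  by rewrite lee_fin tailP_ge0.
have partial n : (\sum_(0 <= k < n) (tailP r p pc y k x)%:E)%E =
    (h x - residual n x)%:E.
  by rewrite sumEFin big_mkord -(tail_sum_residual n v) addrK.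
apply/eqP; rewrite eq_le; apply/andP; split.
  apply: lime_le; first exact: is_cvg_nneseries.
  apply: nearW => n; rewrite partial lee_fin gerBl; exact: residual_ge0.
apply/lee_addgt0Pr => e e0; have [n ne] := residual_small v e0.
apply: (@le_trans _ _ ((h x - residual n x)%:E + e%:E)%E).
  by rewrite -EFinD lee_fin; lra.
by rewrite leeD2r // -partial; exact: nneseries_lim_ge.
Qed.
End Potential.
End Chain.

(** * Entering and leaving the block of a letter *)

Lemma state_eqbF (x y : state) : x <> y -> state_eqb x y = false.
Proof. by move=> ne; apply/state_eqbP. Qed.

Lemma prefix_of_rcons (s t : seq nat) (x : nat) :
  prefix s (rcons t x) = (s == rcons t x) || prefix s t.
Proof.
elim: s t => [|y s IH] [|z t]; rewrite ?prefix0s ?orbT //.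
  by rewrite [rcons _ _]/= prefixs1 orbC prefixs0.
by rewrite rcons_cons !prefix_cons IH eqseq_cons andb_orr.
Qed.

(** Keys with prefix [a . j] belong to [s_j^a], [c_j^a] and their descendants. As [j < r], climbing
    stops at this [j] at the latest, so the only exit is [s_{j+1}^a]. *)
Lemma ret_target_in_block (r : nat) (a : seq nat) (j : nat) (g : seq nat) :
  (j < r)%N -> prefix (rcons a j) g ->
  ret_target r g = Sst j.+1 a \/ prefix (rcons a j) (key (ret_target r g)).
Proof.
move=> jr; elim/last_ind: g => [|g i IH].
  by rewrite prefixs0 -size_eq0 size_rcons.
rewrite prefix_of_rcons ret_target_rcons.
case/orP => [/eqP/rcons_inj[<- <-]|pg]; first by left; rewrite ltn_eqF.
case: (i == r); first exact: IH.
by right; rewrite /= prefix_of_rcons pg orbT.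
Qed.

(** A climb from outside does not pass the letter [j] of [a . j]: it misses the exit and can enter
    only at the head [s_j^a]. *)
Lemma ret_target_outside_block (r : nat) (a : seq nat) (j : nat) (g : seq nat) :
  ~~ prefix (rcons a j) g ->
  ret_target r g <> Sst j.+1 a /\
  (prefix (rcons a j) (key (ret_target r g)) -> ret_target r g = Sst j a).
Proof.
elim/last_ind: g => [|g i IH].
  by move=> _; split => //; rewrite prefixs0 -size_eq0 size_rcons.
rewrite prefix_of_rcons ret_target_rcons negb_or => /andP[ne npg].
case: (i == r); first exact: IH.
split; first by case=> ji ag; rewrite ji ag eqxx in ne.
by rewrite /= prefix_of_rcons (negbTE npg) orbF => /eqP/rcons_inj[-> ->].
Qed.

(** * Mean time to return to [Sharp] *)

Section Mean.
Variables (R : realType) (r : nat) (p pc : R).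
Hypotheses (r_gt0 : (1 <= r)%N) (p01 : 0 <= p <= 1) (pc01 : 0 <= pc <= 1).
Hypothesis (nur_lt1 : p * pc * r%:R < 1).

Let nu := p * pc.

(* The solution of [C = r * Delta] and [Delta = 1 + p * (1 + pc * C)]. *)
Definition exit_time : R := r%:R * (1 + p) / (1 - p * pc * r%:R).
Definition letter_time : R := 1 + p * (1 + pc * exit_time).
Local Notation Cv := exit_time.
Local Notation Dv := letter_time.

Lemma exit_timeE : Cv = r%:R * Dv.
Proof.
have ne : 1 - p * pc * r%:R != 0 by rewrite gt_eqF // subr_gt0.
by rewrite /Dv /Cv; field.
Qed.

Lemma exit_time_ge0 : 0 <= Cv.
Proof.
move: p01 => /andP[p0 _]; apply: divr_ge0; last by rewrite subr_ge0 ltW.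
by rewrite mulr_ge0 // addr_ge0.
Qed.

Lemma letter_time_ge0 : 0 <= Dv.
Proof.
move: p01 pc01 => /andP[p0 _] /andP[c0 _].
by rewrite addr_ge0 // mulr_ge0 // addr_ge0 // mulr_ge0 // exit_time_ge0.
Qed.

(** Number of right siblings along the path [a]: the letters left to process between the end of
    block [a] and [Sharp]. *)
Definition weight (a : seq nat) : nat := \sum_(x <- a) (r - x)%N.

Lemma weight_rcons (a : seq nat) (i : nat) :
  weight (rcons a i) = (weight a + (r - i))%N.
Proof. by rewrite /weight -cats1 big_cat big_seq1. Qed.

Lemma weight_prefix (a b : seq nat) : prefix a b -> (weight a <= weight b)%N.
Proof. by move=> /prefixP[d ->]; rewrite /weight big_cat leq_addr. Qed.

Lemma weight_le (a : seq nat) : (weight a <= r * size a)%N.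
Proof.
elim/last_ind: a => [|a i IH]; first by rewrite /weight big_nil.
by rewrite weight_rcons size_rcons mulnS addnC leq_add // leq_subr.
Qed.

(** Each remaining letter costs [Dv]. At [s_i^a] the current letter is still to be done; at [c_i^a]
    one step remains and, with probability [pc], a child block costing [Cv]. *)
Definition sharp_time (x : state) : R :=
  match x with
  | Sharp => 0
  | Sst _ _ => (weight (key x)).+1%:R * Dv
  | Cst _ _ => 1 + pc * Cv + (weight (key x))%:R * Dv
  end.
Local Notation U := sharp_time.

Lemma sharp_time_ret_target (a : seq nat) :
  valid_word r a -> U (ret_target r a) = (weight a)%:R * Dv.
Proof.
elim/last_ind: a => [|a i IH]; first by rewrite /weight big_nil mul0r.
rewrite valid_rcons ret_target_rcons weight_rcons => /andP[ir va].
case: eqP => [->|ne]; first by rewrite subnn addn0 IH.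
by rewrite /= weight_rcons; congr (_%:R * _); lia.
Qed.

Lemma sharp_time_harmonic (x : state) :
  valid_state r x -> x <> Sharp -> U x = 1 + step r p pc U x.
Proof.
case: x => [//|k b|k b] v _; rewrite ?step_Sst ?step_Cst // sharp_time_ret_target //=.
  by rewrite -natr1 /Dv; ring.
(* Opening a child block adds its [r] letters, worth [Cv] in all. *)
have -> : (weight (rcons (rcons b k) 1)).+1 = (weight (rcons b k) + r)%N.
  by rewrite (weight_rcons (rcons b k)); lia.
by rewrite natrD exit_timeE; ring.
Qed.

Lemma sharp_time_ge0 (x : state) : 0 <= U x.
Proof.
have D0 := letter_time_ge0; have C0 := exit_time_ge0.
move: pc01 => /andP[c0 _].
case: x => [|k b|k b] //=; first exact: mulr_ge0.
by rewrite addr_ge0 // ?mulr_ge0 // addr_ge0 // mulr_ge0.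
Qed.

Lemma sharp_time_growth (x : state) :
  U x <= (1 + Cv + r.+1%:R * Dv) * (size (key x)).+1%:R.
Proof.
have D0 := letter_time_ge0; have C0 := exit_time_ge0.
move: pc01 => /andP[c0 c1].
have W n : (n <= r * size (key x))%N ->
    n.+1%:R * Dv <= r.+1%:R * Dv * (size (key x)).+1%:R.
  move=> nle; rewrite [leRHS]mulrAC -natrM ler_wpM2r // ler_nat.
  by rewrite mulSn mulnS; lia.
have K : 1 + pc * Cv <= (1 + Cv) * (size (key x)).+1%:R.
  apply: (@le_trans _ _ (1 + Cv)); first by rewrite lerD2l ler_piMl.
  by rewrite ler_peMr ?ler1n // addr_ge0.
have K0 : 0 <= 1 + pc * Cv by rewrite addr_ge0 // mulr_ge0.
have := W _ (weight_le (key x)); rewrite mulrDl.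
move: K K0; case: x {W} => [|k b|k b] K K0 W /=.
- by rewrite addr_ge0 // mulr_ge0 // ?addr_ge0 // mulr_ge0.
- by rewrite -[leLHS]add0r lerD // (le_trans K0).
- apply: lerD => //; apply: le_trans W.
  by rewrite ler_wpM2r // ler_nat.
Qed.

Lemma mean_hit_sharp (x : state) :
  valid_state r x -> mean_hit r p pc x Sharp = (U x)%:E.
Proof.
apply: (mean_hit_potential r_gt0 p01 pc01 _ _ _ sharp_time_harmonic) => //.
- by move=> z _; exact: sharp_time_ge0.
- by move=> z _; exact: sharp_time_growth.
Qed.

(** * Moving the target through the tree *)

(* From a state that follows [s_j^a] in lexicographic order, the chain returns
   to [#] before it can hit [s_j^a]; the last clause records this for the states
   that are needed in the induction on the target. *)
Definition hitting_potential (j : nat) (a : seq nat) (h : state -> R) : Prop :=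
  [/\ h (Sst j a) = 0,
      forall x, valid_state r x -> 0 <= h x,
      exists B, forall x, valid_state r x -> h x <= B * (size (key x)).+1%:R,
      forall x, valid_state r x -> x <> Sst j a -> h x = 1 + step r p pc h x
    & forall l d, (j <= l)%N -> valid_word r (a ++ l :: d) ->
        h (ret_target r (a ++ l :: d)) =
        U (ret_target r (a ++ l :: d)) + h Sharp].

(** The target is entered only from [Sharp], so every other state returns to [Sharp] and then makes
    one step. *)
Lemma hitting_potential_first :
  exists h, hitting_potential 1 [::] h /\ h Sharp = 1.
Proof.
pose h x := if state_eqb x (Sst 1 [::]) then 0 else U x + 1.
have hE x : x <> Sst 1 [::] -> h x = U x + 1.
  by move=> ne; rewrite /h state_eqbF.
have h0 : h (Sst 1 [::]) = 0 by rewrite /h state_eqb_refl.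
have hS : h Sharp = 1 by rewrite hE //= add0r.
have U0 := sharp_time_ge0.
exists h; split=> //; split => //.
- by move=> x _; rewrite /h; case: ifP => // _; rewrite addr_ge0.
- exists (1 + Cv + r.+1%:R * Dv + 1) => x _; rewrite mulrDl mul1r.
  apply: (@le_trans _ _ (U x + 1)).
    by rewrite /h; case: ifP => // _; rewrite addr_ge0.
  by rewrite lerD ?sharp_time_growth // ler1n.
- move=> x v ne.
  case: x v ne => [|k b|k b] v ne.
  + by rewrite step_Sharp h0 addr0.
  + rewrite (hE _ ne) (sharp_time_harmonic v) // !step_Sst // !hE //; first by ring.
    exact: ret_target_neq_first.
  + rewrite (hE _ ne) (sharp_time_harmonic v) // !step_Cst // !hE //; first by ring.
    exact: ret_target_neq_first.
    by case=> /(congr1 size); rewrite size_rcons.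
- move=> l d _ v; rewrite hS hE //; exact: ret_target_neq_first.
Qed.

(** From inside the block of [a . j] the way to [Sharp] leads through [s_{j+1}^a], so the time is a
    difference of values of [U]. From elsewhere the chain first hits [s_j^a], then spends [Dv]. *)
Lemma hitting_potential_sibling (j : nat) (a : seq nat) (h : state -> R) :
  (j < r)%N -> valid_word r (rcons a j) -> hitting_potential j a h ->
  exists h', hitting_potential j.+1 a h' /\ h' Sharp = h Sharp + Dv.
Proof.
move=> jr va [h0 hge0 [B hB] hharm hafter].
have j0 : (0 < j)%N by move: va; rewrite valid_rcons => /andP[/andP[]].
pose y' := Sst j.+1 a.
pose h' x := if state_eqb x y' then 0 else
  if prefix (rcons a j) (key x) then U x - U y' else h x + Dv.
have Uy' : U y' = (weight (rcons a j))%:R * Dv.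
  by rewrite -sharp_time_ret_target // ret_target_rcons ltn_eqF.
have U_ge x : x <> Sharp -> prefix (rcons a j) (key x) -> U y' <= U x.
  move=> nx /weight_prefix; rewrite Uy' => le.
  have D0 := letter_time_ge0; have C0 := exit_time_ge0.
  move: pc01 => /andP[c0 _].
  case: x nx le => [//|k b|k b] _ le.
    by rewrite ler_wpM2r // ler_nat ltnW.
  rewrite [leRHS]/= -[leLHS]add0r lerD //; first by rewrite addr_ge0 // mulr_ge0.
  by rewrite ler_wpM2r // ler_nat.
have h'0 : h' y' = 0 by rewrite /h' state_eqb_refl.
have h'in x : x = y' \/ prefix (rcons a j) (key x) -> h' x = U x - U y'.
  rewrite /h'; case: (@state_eqbP x y') => [-> _|nx]; first by rewrite subrr.
  by case=> // ->.
(* At the head [s_j^a] the two formulas agree: both give [Dv]. *)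
have h'out x : x <> y' -> (prefix (rcons a j) (key x) -> x = Sst j a) ->
    h' x = h x + Dv.
  move=> ne out; rewrite /h' state_eqbF //; case: ifP => // /out ->.
  by rewrite h0 Uy' /= -natr1; ring.
have no_prefix_nil : ~~ prefix (rcons a j) [::].
  by rewrite prefixs0 -size_eq0 size_rcons.
have h'S : h' Sharp = h Sharp + Dv.
  by rewrite h'out // => pre; rewrite pre in no_prefix_nil.
exists h'; split=> //; split => //.
- move=> x v; rewrite /h'; case: ifP => // _; case: ifP => pre.
    rewrite subr_ge0 U_ge // => xS.
    by move: pre; rewrite xS (negbTE no_prefix_nil).
  by rewrite addr_ge0 ?hge0 // letter_time_ge0.
- exists (B + Dv + (1 + Cv + r.+1%:R * Dv)) => x v; rewrite 2!mulrDl.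
  have D0 := letter_time_ge0.
  have b1 := le_trans (hge0 _ v) (hB _ v).
  have b2 := le_trans (sharp_time_ge0 x) (sharp_time_growth x).
  have b3 : Dv <= Dv * (size (key x)).+1%:R by rewrite ler_peMr // ler1n.
  have b4 := hB _ v; have b5 := sharp_time_growth x.
  have b6 := sharp_time_ge0 y'.
  by rewrite /h'; case: ifP => _; [lra|case: ifP => _; lra].
- move=> x v ne; case: (boolP (prefix (rcons a j) (key x))) => pre.
    rewrite h'in; last by right.
    case: x v ne pre => [|k b|k b] v ne pre.
    + by rewrite pre in no_prefix_nil.
    + rewrite sharp_time_harmonic // !step_Sst // !h'in; first by ring.
      * exact: ret_target_in_block.
      * by right.
    + rewrite sharp_time_harmonic // !step_Cst // !h'in; first by ring.
      * exact: ret_target_in_block.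
      * by right; apply: prefix_trans pre (prefix_rcons _ _).
  rewrite h'out ?(negbTE pre) // hharm //; last first.
    by move=> xE; rewrite xE prefix_refl in pre.
  case: x v ne pre => [|k b|k b] v ne pre.
  + rewrite !step_Sharp h'out ?addrA //.
      by case=> j0'; rewrite -j0' in j0.
    have -> : key (Sst 1 [::]) = rcons [::] 1%N by [].
    rewrite prefix_of_rcons (negbTE no_prefix_nil) orbF.
    by move=> /eqP/rcons_inj[<- <-].
  + have [r1 r2] := ret_target_outside_block r pre.
    rewrite !step_Sst // !h'out // ?(negbTE pre) //; ring.
  + have [r1 r2] := ret_target_outside_block r pre.
    rewrite !step_Cst // !h'out //; first by ring.
      by case=> j0'; rewrite -j0' in j0.
    rewrite /= prefix_of_rcons => /orP[/eqP/rcons_inj[<- <-]//|pre'].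
    by rewrite pre' in pre.
- move=> l d jl v.
  have pre : ~~ prefix (rcons a j) (a ++ l :: d).
    by rewrite -cats1 prefix_catr // eqxx prefix_cons (ltn_eqF jl).
  have [r1 r2] := ret_target_outside_block r pre.
  by rewrite h'out // hafter ?(ltnW jl) // h'S -addrA.
Qed.

(** The child is entered only from [c_j^a]. Other states first hit [s_j^a] and then need the mean
    time [T] of the attempts; [c_j^a] is already inside an attempt and gets its own value. *)
Lemma hitting_potential_child (j : nat) (a : seq nat) (h : state -> R) :
  0 < nu -> valid_word r (rcons a j) -> hitting_potential j a h ->
  exists h', hitting_potential 1 (rcons a j) h' /\
    h' Sharp =
    (h Sharp + 1 + p + (1 - nu) * ((weight (rcons a j))%:R * Dv)) / nu.
Proof.
move=> nu0 va [h0 hge0 [B hB] hharm hafter].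
move: (p01) (pc01) => /andP[p0 p1] /andP[c0 c1].
have nu1 : nu <= 1 by rewrite mulr_ile1.
pose z := ret_target r (rcons a j); pose y' := Sst 1 (rcons a j).
(* [z] follows [s_j^a], so the last clause, with empty [d], routes it through [Sharp]. *)
have hz : h z = (weight (rcons a j))%:R * Dv + h Sharp.
  by have := hafter j [::] (leqnn j); rewrite cats1 sharp_time_ret_target //; apply.
have hz0 : 0 <= h z by apply: hge0; exact: valid_ret_target.
(* Mean time from [s_j^a] to its child: each attempt lasts [1 + p] on average
   and fails with probability [1 - nu], in which case the chain restarts at [z]. *)
pose T := (1 + p + (1 - nu) * h z) / nu.
have T0 : 0 <= T.
  by rewrite divr_ge0 ?(ltW nu0) // !addr_ge0 // mulr_ge0 // subr_ge0.
have TE : T = 1 + p + (1 - nu) * (h z + T).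
  by rewrite /T; field; rewrite gt_eqF.
pose h' x := if state_eqb x y' then 0 else
  if state_eqb x (Cst j a) then 1 + (1 - pc) * (h z + T) else h x + T.
have h'0 : h' y' = 0 by rewrite /h' state_eqb_refl.
have h'c : h' (Cst j a) = 1 + (1 - pc) * (h z + T) by rewrite /h' /= !eqxx.
have h'E x : x <> y' -> x <> Cst j a -> h' x = h x + T.
  by move=> n1 n2; rewrite /h' !state_eqbF.
have h'ret g : valid_word r g -> h' (ret_target r g) = h (ret_target r g) + T.
  move=> v; rewrite h'E //; first exact: ret_target_neq_first.
  exact: ret_target_is_Cst.
have h'S : h' Sharp = h Sharp + T by rewrite h'E.
exists h'; split; last first.
  by rewrite h'S /T hz; field; rewrite gt_eqF.
split => //.
- move=> x v; rewrite /h'; case: ifP => // _; case: ifP => _.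
    by rewrite addr_ge0 // mulr_ge0 // ?subr_ge0 // addr_ge0.
  by rewrite addr_ge0 // hge0.
- exists (B + (1 + (h z + T))) => x v; rewrite mulrDl.
  have b1 := le_trans (hge0 _ v) (hB _ v).
  have b2 : 1 + (h z + T) <= (1 + (h z + T)) * (size (key x)).+1%:R.
    by rewrite ler_peMr ?ler1n // !addr_ge0.
  have b3 : (1 - pc) * (h z + T) <= h z + T.
    by rewrite ler_piMl ?addr_ge0 // gerBl.
  have b4 := hB _ v.
  by rewrite /h'; case: ifP => _; [lra|case: ifP => _; lra].
- case=> [|k b|k b] v ne.
  + rewrite step_Sharp !h'E //; last by case=> /(congr1 size); rewrite size_rcons.
    by rewrite hharm // step_Sharp addrA.
  + rewrite step_Sst // h'ret //.
    case: (@state_eqbP (Sst k b) (Sst j a)) => [[-> ->]|nx].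
      have yy' : Sst j a <> y'.
        by case=> _ /(congr1 size)/eqP; rewrite size_rcons ltn_eqF.
      by rewrite h'c h'E // h0 add0r -/z {1}TE /nu; ring.
    rewrite !h'E //; last by case=> kj ba; apply: nx; rewrite kj ba.
    by rewrite hharm // step_Sst //; ring.
  + rewrite step_Cst // h'ret //.
    case: (@state_eqbP (Cst k b) (Cst j a)) => [[-> ->]|nx].
      by rewrite h'c h'0 -/z; ring.
    rewrite !h'E //; last by case=> /rcons_inj[ba kj]; apply: nx; rewrite kj ba.
    by rewrite hharm // step_Cst //; ring.
(* The word is [a ++ j :: l :: d], so the clause for [h] applies at the letter [j]. *)
- move=> l d _ v; rewrite h'ret // h'S.
  by rewrite cat_rcons in v *; rewrite hafter // addrA.
Qed.

(** * Closed form of the hitting time *)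

(** Mean time from [Sharp] to [s_1^a]: the sum of the theorem indexed from 0, with inner sums
    written as weights of prefixes. *)
Definition first_child_time (a : seq nat) : R :=
  nu ^- size a +
  \sum_(0 <= k < size a)
    ((1 + p + (nth 0%N a k).-1%:R * Dv
      + (1 - nu) * ((weight (take k.+1 a))%:R * Dv)) * nu ^- (size a - k)).

(** The recursion of [hitting_potential_child] after [j - 1] sibling moves: the new letter gives the
    last summand, and all older terms are divided by [nu]. *)
Lemma first_child_time_rcons (a : seq nat) (j : nat) : 0 < nu ->
  first_child_time (rcons a j) =
  (first_child_time a + (j.-1)%:R * Dv + 1 + p
   + (1 - nu) * ((weight (rcons a j))%:R * Dv)) / nu.
Proof.
move=> nu0; have nuN : nu != 0 by rewrite gt_eqF.
rewrite /first_child_time size_rcons big_nat_recr //=.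
rewrite nth_rcons ltnn eqxx -(size_rcons a j) take_size size_rcons subSnn expr1.
under eq_big_nat => k /andP[_ kt].
  rewrite nth_rcons kt -cats1 takel_cat // subSn ?(ltnW kt) // exprS invfM.
  rewrite [_^-1 * _]mulrC mulrA; over.
by rewrite -mulr_suml exprS invfM; field; rewrite nuN expf_neq0.
Qed.

(** Outer induction on the word, inner induction on [j]: a child move (or the base state) gives
    [j = 1], sibling moves the rest. Each child move divides by [nu], hence the side condition. *)
Lemma hitting_potential_exists (a : seq nat) (j : nat) :
  valid_word r (rcons a j) -> a = [::] \/ 0 < nu ->
  exists h, hitting_potential j a h /\
    h Sharp = first_child_time a + (j.-1)%:R * Dv.
Proof.
elim/last_ind: a j => [|a i IHa] j v side.
  have F0 : first_child_time [::] = 1.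
    by rewrite /first_child_time big_geq // expr0 invr1 addr0.
  move: v; rewrite valid_rcons F0 andbT.
  elim: j => [//|[|j] IHj] jr; first by rewrite mul0r addr0;
    exact: hitting_potential_first.
  have [//|h [hpot hS]] := IHj.
    by lia.
  have [||h' [h'pot h'S]] := hitting_potential_sibling _ _ hpot.
  - by [].
  - by rewrite valid_rcons /= andbT; lia.
  by exists h'; split=> //; rewrite h'S hS /= -[in RHS]natr1; ring.
have nu0 : 0 < nu by case: side => // /(congr1 size); rewrite size_rcons.
move: v; rewrite valid_rcons => /andP[jr va].
elim: j jr => [//|[|j] IHj] jr.
  have [|h [hpot hS]] := IHa i va; first by right.
  have [h' [h'pot h'S]] := hitting_potential_child nu0 va hpot.
  by exists h'; split=> //; rewrite h'S hS mul0r addr0 first_child_time_rcons.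
have [|h [hpot hS]] := IHj; first by lia.
have [||h' [h'pot h'S]] := hitting_potential_sibling _ _ hpot.
- by [].
- by rewrite valid_rcons va andbT; lia.
by exists h'; split=> //; rewrite h'S hS /= -[in RHS]natr1; ring.
Qed.

Lemma mean_hit_Sst (a : seq nat) (j : nat) :
  valid_word r (rcons a j) -> a = [::] \/ 0 < nu ->
  mean_hit r p pc Sharp (Sst j a) =
  (first_child_time a + (j.-1)%:R * Dv)%:E.
Proof.
move=> v side; have [h [[h0 hge0 [B hB] hharm _] <-]] :=
  hitting_potential_exists v side.
exact: (mean_hit_potential r_gt0 p01 pc01 h0 hge0 hB hharm).
Qed.

(** Identifies [exit_time] with the [C] of the theorem: the word [1] has weight [r - 1]. *)
Lemma mean_hit_first_sharp : mean_hit r p pc (Sst 1 [::]) Sharp = Cv%:E.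
Proof.
rewrite mean_hit_sharp; last by rewrite /valid_state /valid_word /= r_gt0.
by rewrite exit_timeE /= /weight big_seq1 subn1 prednK.
Qed.
End Mean.

Theorem theorem3p5 (R : realType) (r : nat) (p pc : R) (alpha : seq nat)
    (i : nat) :
  (1 <= r)%N ->
  0 <= p <= 1 -> 0 <= pc <= 1 ->
  (p * pc) * r%:R < 1 ->
  valid_word r alpha ->
  (1 <= i <= r)%N ->
  (size alpha = 0%N \/ 0 < p * pc) ->
  let nu := p * pc in
  let t := size alpha in
  let C := mean_hit r p pc (Sst 1 [::]) Sharp in
  let Delta := (1%:E + p%:E * (1%:E + pc%:E * C))%E in
  mean_hit r p pc Sharp (Sst i alpha) =
  ((nu ^- t)%:E + (i.-1)%:R%:E * Delta +
   \sum_(1 <= k < t.+1)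
     (((1 + p)%:E + (nth 0 alpha k.-1).-1%:R%:E * Delta
       + (1 - nu)%:E *
         \sum_(1 <= s < k.+1) ((r - nth 0 alpha s.-1)%:R%:E * Delta))
      * (nu ^- (t.+1 - k))%:E))%E.
Proof.
move=> r0 p01 pc01 nur va ir side nu t C Delta.
have -> : Delta = (letter_time r p pc)%:E.
  by rewrite /Delta /C mean_hit_first_sharp // -!EFinM -!EFinD.
rewrite mean_hit_Sst //; first last.
- by case: side => [/size0nil|]; [left|right].
- by rewrite valid_rcons ir.
have weightE k : (k <= t)%N -> (\sum_(1 <= s < k.+1)
    ((r - nth 0%N alpha s.-1)%:R%:E * (letter_time r p pc)%:E))%E =
    ((weight r (take k alpha))%:R * letter_time r p pc)%:E.
  elim: k => [|k IH] kt; first by rewrite big_geq // take0 /weight big_nil mul0r.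
  rewrite big_nat_recr // IH 1?ltnW // (take_nth 0%N) // weight_rcons.
  by rewrite natrD mulrDl EFinD EFinM.
(* After the shift of [k] by one, the exponent [t + 1 - k] becomes [t - k], as in
   [first_child_time]. *)
rewrite big_add1 /=.
under eq_big_nat => k /andP[_ kt].
  rewrite weightE // subSS -!EFinM; over.
rewrite sumEFin -EFinM -!EFinD; congr (_%:E).
by rewrite /first_child_time addrAC.
Qed.
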